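(* Let $G$ be a countable group. For a generic probability measure $\nu$ on $G$, the amenable radical of $G$ acts trivially on the Poisson boundary $\partial(G,\nu)$ (that is, every element of the amenable radical fixes almost every point).
   Context: The amenable radical of $G$ is its maximal normal amenable subgroup. $\mathcal{M}(G)$ is the space of all probability measures on $G$ with the total variation ($\ell^1$) distance. A property holds for a generic probability measure if the set of measures having it is residual (contains a countable intersection of dense open sets) in $\mathcal{M}(G)$. Properties of the action on the Poisson boundary are understood to include non-degeneracy of $\nu$: $\nu$ is non-degenerate if its support generates $G$ as a semigroup. Poisson boundary: let $(X_i)_{i\ge 1}$ be i.i.d. with distribution $\nu$, $Z_i=X_1\cdots X_i$, and let $\eta$ be the distribution of $(Z_i)_{i\geq 1}$ on $\Omega=\prod_{i\ge1}G$. The Poisson boundary $\partial(G,\nu)$ is the space of ergodic components of the time shift on $(\Omega,\eta)$, i.e. the standard probability space together with a measurable map $\Omega\to\partial(G,\nu)$ such that the preimage of its $\sigma$-algebra is, modulo $\eta$-null sets, the $\sigma$-algebra of shift-invariant measurable sets (for non-degenerate $\nu$ this coincides with the tail $\sigma$-algebra mod $\eta$). The coordinatewise action $\gamma\cdot(g_1,g_2,\ldots)=(\gamma g_1,\gamma g_2,\ldots)$ induces, for non-degenerate $\nu$, a quasi-invariant (measure-class preserving) action of $G$ on $\partial(G,\nu)$. *)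

(* Defs.v *)
From HB Require Import structures.
From mathcomp Require Import all_boot all_order all_algebra.
From mathcomp Require Import all_classical all_reals all_analysis.
From mathcomp Require Import borel_hierarchy.

Set Implicit Arguments.
Unset Strict Implicit.
Unset Printing Implicit Defensive.

Import Order.TTheory GRing.Theory Num.Theory.
Import numFieldNormedType.Exports.

Local Open Scope classical_set_scope.
Local Open Scope ring_scope.

Section amenability.
Context (R : realType) (G : groupType).
Implicit Types N M : set G.

Definition is_subgroup N := group_closed (mem N).

Definition is_normal_subgroup N :=
  is_subgroup N /\ forall x g : G, N x -> N (x ^ g)%g.

(* A left-invariant mean on l^oo(N). Elements of l^oo(N) are represented by
   functions on G that are bounded on N; by linearity and [mean_pos] the value
   of the mean depends only on the restriction to N. *)
Record is_invariant_mean N (m : (G -> R) -> R) : Prop := {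
  mean_linear : forall (a : R) (f f' : G -> R),
    [bounded f x | x in N] -> [bounded f' x | x in N] ->
    m (fun x => a * f x + f' x) = a * m f + m f' ;
  mean_pos : forall f : G -> R, [bounded f x | x in N] ->
    (forall x, N x -> 0 <= f x) -> 0 <= m f ;
  mean_one : m (fun=> 1) = 1 ;
  mean_invariant : forall (h : G) (f : G -> R), N h ->
    [bounded f x | x in N] -> m (fun x => f (h^-1 * x)%g) = m f }.

Definition amenable N := exists m, is_invariant_mean N m.

Definition is_amenable_radical N :=
  [/\ is_normal_subgroup N, amenable N &
      forall M, is_normal_subgroup M -> amenable M -> N `<=` M -> M = N].

End amenability.

(* [discr G] is G with the discrete sigma-algebra. *)
Definition discr (G : groupType) : Type := G.

HB.instance Definition _ (G : groupType) := Choice.on (discr G).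
HB.instance Definition _ (G : groupType) := isPointed.Build (discr G) (1%g : G).
HB.instance Definition _ (G : groupType) :=
  @isMeasurable.Build default_measure_display (discr G)
    discrete_measurable discrete_measurable0
    discrete_measurableC discrete_measurableU.

Section total_variation.
Context (R : realType) (G : groupType).
Implicit Types mu nu : probability (discr G) R.

Local Open Scope ereal_scope.

Definition l1_dist mu nu : \bar R :=
  \esum_(g in [set: discr G]) `|mu [set g] - nu [set g]|.

Definition l1_ball mu (e : R) : set (probability (discr G) R) :=
  [set nu | l1_dist mu nu < e%:E].

Lemma l1_ball_center mu (e : R) : (0 < e)%R -> l1_ball mu e mu.
Proof.
move=> e0; rewrite /l1_ball /l1_dist/= esum1 ?lte_fin// => g _.
by rewrite subee ?abse0// fin_num_measure.
Qed.

Lemma l1_ball_sym mu nu (e : R) : l1_ball mu e nu -> l1_ball nu e mu.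
Proof.
rewrite /l1_ball /l1_dist/= => h; apply: le_lt_trans h.
apply: le_esum => g _.
rewrite -[mu [set g]]fineK ?fin_num_measure// -[nu [set g]]fineK ?fin_num_measure//.
by rewrite -!EFinB !abse_EFin distrC.
Qed.

Lemma l1_ball_triangle mu nu xi (e1 e2 : R) :
  l1_ball mu e1 nu -> l1_ball nu e2 xi -> l1_ball mu (e1 + e2) xi.
Proof.
rewrite /l1_ball /l1_dist/= => h1 h2.
rewrite EFinD; apply: le_lt_trans (lteD h1 h2).
rewrite -esumD//; apply: le_esum => g _.
have f (p : probability (discr G) R) : p [set g] \is a fin_num.
  exact: fin_num_measure.
rewrite -[mu [set g]]fineK// -[nu [set g]]fineK// -[xi [set g]]fineK//.
by rewrite -!EFinB !abse_EFin -EFinD lee_fin ler_distD.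
Qed.

Definition l1_ent := entourage_ l1_ball.

HB.instance Definition _ :=
  hasNbhs.Build (probability (discr G) R) (nbhs_ l1_ent).

HB.instance Definition _ :=
  @Nbhs_isPseudoMetric.Build R (probability (discr G) R) l1_ent erefl
    l1_ball l1_ball_center l1_ball_sym l1_ball_triangle erefl.

End total_variation.

Definition residual (T : topologicalType) (A : set T) :=
  exists2 S : set T, Gdelta_dense S & S `<=` A.

Definition measure_support (R : realType) (G : groupType)
    (nu : probability (discr G) R) : set G :=
  [set g | (0 < nu [set g])%E].

Definition semigroup_span (G : groupType) (S : set G) : set G :=
  smallest [set H : set G | forall x y, H x -> H y -> H (x * y)%g] S.

Definition nondegenerate_measure (R : realType) (G : groupType)
    (nu : probability (discr G) R) :=
  semigroup_span (measure_support nu) = [set: G].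

(* The space of trajectories (g_1, g_2, ...), where g_i is stored at index
   i.-1, with the product of the discrete sigma-algebras. *)
Definition cylinders (G : groupType) : set (set (nat -> discr G)) :=
  [set C | exists n (A : set G), C = [set w | A (w n)]].

Definition path_space (G : groupType) := g_sigma_algebraType (@cylinders G).

HB.instance Definition _ (G : groupType) := Measurable.on (path_space G).

Section random_walk.
Context (R : realType) (G : groupType).

Section iid.
Context d (T : measurableType d) (P : probability T R).

(* Independence is required of initial segments only: taking some of the A i
   to be the full set gives every finite subfamily. *)
Definition iid (nu : probability (discr G) R) (X : nat -> {RV P >-> discr G}) :=
  (forall i (A : set G), distribution P (X i) A = nu A) /\
  (forall n (A : nat -> set G),
     P (\bigcap_(i < n) (X i @^-1` A i)) =
     (\prod_(i < n) P (X i @^-1` A i))%E).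

Definition walk (X : nat -> {RV P >-> discr G}) (t : T) : path_space G :=
  fun n => (\prod_(0 <= i < n.+1) (X i t : G))%g.

End iid.

(* eta is the distribution of (Z_n), Z_n = X_1 ... X_n, for some i.i.d.
   sequence (X_n) with distribution nu; it is uniquely determined by nu. *)
Definition is_walk_distribution (nu : probability (discr G) R)
    (eta : probability (path_space G) R) :=
  exists (d : measure_display) (T : measurableType d) (P : probability T R)
    (X : nat -> {RV P >-> discr G}),
    iid nu X /\ forall E, measurable E -> eta E = P (walk X @^-1` E).

End random_walk.

Definition shift (G : groupType) (w : path_space G) : path_space G :=
  fun n => w n.+1.

Definition translate (G : groupType) (g : G) (w : path_space G) : path_space G :=
  fun n => (g * (w n : G))%g.

Definition shift_invariant (G : groupType) (E : set (path_space G)) :=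
  measurable E /\ @shift G @^-1` E = E.

(* B is isomorphic, as a measurable space, to a Polish space with its Borel
   sigma-algebra. *)
Definition standard_borel (R : realType) d (B : measurableType d) :=
  exists (X : completePseudoMetricType R) (f : B -> X),
    [/\ hausdorff_space X, @second_countable X, bijective f &
        @measurable d B = [set f @^-1` A | A in <<s @open X >>]].

Section boundary.
Context (R : realType) (G : groupType) (eta : probability (path_space G) R).
Context d (B : measurableType d).

Record is_poisson_boundary (mu : probability B R) (bnd : path_space G -> B) :
    Prop := {
  boundary_standard : standard_borel R B ;
  boundary_measurable : measurable_fun setT bnd ;
  boundary_law : forall A, measurable A -> mu A = eta (bnd @^-1` A) ;
  boundary_invariant : forall A, measurable A ->
    exists2 E, shift_invariant E & eta ((bnd @^-1` A) `+` E) = 0%E ;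
  boundary_complete : forall E, shift_invariant E ->
    exists2 A, measurable A & eta ((bnd @^-1` A) `+` E) = 0%E }.

(* The coordinatewise action descends to B only up to null sets: each [act g]
   is a representative, determined mu-almost everywhere by equivariance (as
   mu is the image of eta), and the group laws and quasi-invariance then hold
   almost everywhere when the walk is non-degenerate. *)
Record is_induced_action (bnd : path_space G -> B) (act : G -> B -> B) :
    Prop := {
  act_measurable : forall g, measurable_fun setT (act g) ;
  act_equivariant : forall g,
    {ae eta, forall w, bnd (translate g w) = act g (bnd w)} }.

End boundary.

Definition acts_trivially_on_boundary (R : realType) (G : groupType)
    (N : set G) (nu : probability (discr G) R) :=
  forall eta : probability (path_space G) R, is_walk_distribution nu eta ->
  forall (d : measure_display) (B : measurableType d) (mu : probability B R)
    (bnd : path_space G -> B) (act : G -> B -> B),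
    is_poisson_boundary eta mu bnd -> is_induced_action eta bnd act ->
  forall g, N g -> {ae mu, forall b, act g b = b}.

(* Main.v *)
From HB Require Import structures.
Require Import Defs.
From mathcomp Require Import all_boot all_order all_algebra.
From mathcomp Require Import all_classical all_reals all_analysis.
From mathcomp Require Import ring lra.

(** Let [N] be the amenable radical. A mean on [N] is upgraded, by a separation
    argument, to finitely supported measures on [N] which are almost invariant
    under any prescribed finite subset of [N]. Mixing a small multiple of such a
    measure into [nu] makes [nu^n] almost invariant, in total variation, under a
    given [h] in [N]: moving [h] to the right past an increment [x] replaces it
    by its conjugate [h ^ x], again in [N], until the first increment drawn from
    the added measure absorbs it. Almost invariance for some [n] is an open
    condition on [nu], so generically every [h] in [N] is almost invariant to any
    precision, and then every bounded harmonic function is invariant under [N],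
    on the right and hence, [N] being normal, also on the left. Applied to
    [g |-> P(g Z \in E)] for shift-invariant events [E], this gives
    [E = h^-1 E] almost surely for [h] in [N], since the values of that function
    determine [E] up to null sets. Generically [nu] also charges every element;
    translations then preserve null sets of the whole path space, which lets one
    pass from shift-invariant events to the boundary. *)

Set Implicit Arguments.
Unset Strict Implicit.
Unset Printing Implicit Defensive.
Import Order.TTheory GRing.Theory Num.Theory.
Import numFieldNormedType.Exports.
Local Open Scope classical_set_scope.
Local Open Scope ring_scope.

(** * Hahn-Banach theorem *)

Section hahn_banach.
Context (R : realType) (V : lmodType R).
Implicit Types (p q : V -> R) (x y : V) (A : set (V -> R)).

Definition sublinear p :=
  (forall x y, p (x + y) <= p x + p y) /\
  (forall a x, 0 <= a -> p (a *: x) = a * p x).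

Lemma sublinear0 p : sublinear p -> p 0 = 0.
Proof. by move=> [_ pZ]; rewrite -(scale0r 0) pZ// mul0r. Qed.

Lemma sublinear_opp_le p x : sublinear p -> - p (- x) <= p x.
Proof.
move=> sp; have [pD _] := sp; have := pD x (- x).
by rewrite subrr sublinear0//; lra.
Qed.

(** The inequality for [a^-1] at [a *: x] is the converse of the inequality for [a] at [x]. *)
Lemma sublinearI p :
  (forall x y, p (x + y) <= p x + p y) ->
  (forall a x, 0 < a -> p (a *: x) <= a * p x) -> p 0 = 0 -> sublinear p.
Proof.
move=> pD pZ p0; split=> // a x; rewrite le_eqVlt => /predU1P[<-|a0].
  by rewrite scale0r mul0r.
apply/eqP; rewrite eq_le pZ//=.
have := pZ a^-1 (a *: x); rewrite invr_gt0 => /(_ a0).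
rewrite scalerA mulVf ?gt_eqF// scale1r => /(ler_wpM2l (ltW a0)).
by rewrite mulrA divff ?gt_eqF// mul1r.
Qed.

Definition pointwise_inf A x := inf [set p x | p in A].

(** The infimum is finite because [- q (- x)] bounds every [p x] from below. Subadditivity uses the
    chain: near-minimisers at [x] and at [y] can both be replaced by the smaller of the two. *)
Lemma pointwise_inf_sublinear A q : A !=set0 ->
  total_on A (fun p p' => forall x, p' x <= p x) ->
  (forall p, A p -> sublinear p /\ forall x, p x <= q x) ->
  sublinear (pointwise_inf A) /\ forall p, A p -> forall x, pointwise_inf A x <= p x.
Proof.
move=> [p0 Ap0] totA Asub.
have hasinf x : has_inf [set p x | p in A].
  split; first by exists (p0 x), p0.
  exists (- q (- x)) => _ [p Ap <-].
  have [sp pq] := Asub _ Ap.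
  by rewrite (le_trans _ (sublinear_opp_le x sp))// lerN2.
have infle p : A p -> forall x, pointwise_inf A x <= p x.
  by move=> Ap x; apply: ge_inf; [case: (hasinf x)|exists p].
split=> //; apply: sublinearI.
- move=> x y; apply/ler_addgt0Pr => e e0.
  have e20 : 0 < e / 2 by rewrite divr_gt0.
  have [_ [f Af <-] fx] := inf_adherent e20 (hasinf x).
  have [_ [g Ag <-] gy] := inf_adherent e20 (hasinf y).
  have [h [Ah hf hg]] : exists h, [/\ A h, forall z, h z <= f z & forall z, h z <= g z].
    by case: (totA _ _ Af Ag) => fg; [exists g|exists f]; split.
  apply: (le_trans (infle _ Ah _)); apply: (le_trans ((Asub _ Ah).1.1 _ _)).
  have := hf x; have := hg y; rewrite -/(pointwise_inf A x) in fx.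
  rewrite -/(pointwise_inf A y) in gy; lra.
- move=> a x a0; rewrite -ler_pdivrMl//; apply: lb_le_inf; first by case: (hasinf x).
  move=> _ [p Ap <-]; rewrite ler_pdivrMl// -(Asub _ Ap).1.2 ?(ltW a0)//.
  exact: infle.
- apply/eqP; rewrite eq_le; apply/andP; split.
    by rewrite -(sublinear0 (Asub _ Ap0).1) infle.
  apply: lb_le_inf; first by case: (hasinf 0).
  by move=> _ [p Ap <-]; rewrite (sublinear0 (Asub _ Ap).1).
Qed.

(* A minimal sublinear functional [p] is linear: the sublinear functional
   [x |-> inf_(t >= 0) p (x + t y) - t (p y)] is below [p], hence equal to it. *)
Lemma minimal_sublinear_linear p : sublinear p ->
  (forall q, sublinear q -> (forall x, q x <= p x) -> q = p) ->
  forall a x y, p (a *: x + y) = a * p x + p y.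
Proof.
move=> sp pmin.
have pD x y : p (x + y) = p x + p y.
  apply/eqP; rewrite eq_le sp.1/= addrC -lerBrDl.
  pose S x := [set p (x + t *: y) - t * p y | t in [set t : R | 0 <= t]].
  have hasinf z : has_inf (S z).
    split; first by exists (p (z + 0 *: y) - 0 * p y), 0 => /=.
    exists (- p (- z)) => _ [t /= t0 <-].
    have := sp.1 (z + t *: y) (- z); rewrite addrAC subrr add0r sp.2//.
    lra.
  have infle t z : 0 <= t -> inf (S z) <= p (z + t *: y) - t * p y.
    by move=> t0; apply: ge_inf; [case: (hasinf z)|exists t].
  (* The parameter [t = 1] bounds [inf (S x)] by [p (x + y) - p y]. *)
  suff -> : p x = inf (S x).
    by have := infle 1 x ler01; rewrite scale1r mul1r lerBrDl (addrC (p y)) addrC; lra.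
  rewrite -[in LHS](pmin (fun z => inf (S z)))//; last first.
    by move=> z; have := infle 0 z (lexx 0); rewrite scale0r mul0r addr0 subr0.
  apply: sublinearI.
  - move=> z w; apply/ler_addgt0Pr => e e0.
    have e20 : 0 < e / 2 by rewrite divr_gt0.
    have [_ [t /= t0 <-] tz] := inf_adherent e20 (hasinf z).
    have [_ [s /= s0 <-] sw] := inf_adherent e20 (hasinf w).
    apply: (le_trans (infle (t + s) _ (addr_ge0 t0 s0))).
    have := sp.1 (z + t *: y) (w + s *: y).
    rewrite addrACA -scalerDl; lra.
  - move=> a z a0; rewrite -ler_pdivrMl//; apply: lb_le_inf; first by case: (hasinf z).
    move=> _ [t /= t0 <-]; rewrite ler_pdivrMl// mulrBr -sp.2 ?(ltW a0)// scalerDr.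
    by rewrite scalerA mulrA; apply: infle; rewrite mulr_ge0// ltW.
  - apply/eqP; rewrite eq_le; apply/andP; split.
      by have := infle 0 0 (lexx 0); rewrite scale0r addr0 sublinear0// mul0r subr0.
    apply: lb_le_inf; first by case: (hasinf 0).
    by move=> _ [t /= t0 <-]; rewrite add0r sp.2// subrr.
move=> a x y; rewrite pD; congr (_ + _).
have [a0|/ltW a0] := leP 0 a; first exact: sp.2.
have pN z : p (- z) = - p z.
  by apply/eqP; rewrite -addr_eq0 -pD addNr sublinear0.
by rewrite -[a *: x]opprK -scaleNr pN sp.2 ?oppr_ge0// mulNr opprK.
Qed.

(** Zorn's lemma for the reversed pointwise order gives a minimal sublinear functional below [q],
    which is linear. A chain is bounded by its pointwise infimum, the empty chain by [q]. *)
Lemma hahn_banach q : sublinear q -> exists2 phi : V -> R,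
  forall a x y, phi (a *: x + y) = a * phi x + phi y & forall x, phi x <= q x.
Proof.
move=> sq; pose T := {p : V -> R | sublinear p /\ forall x, p x <= q x}.
have [[p [sp pq]] pmin] : exists t : T, forall s : T,
    `[< forall x, sval s x <= sval t x >] -> s = t.
  apply: (@Zorn T (fun p p' : T => `[< forall x, sval p' x <= sval p x >])).
  - by move=> t; exact/asboolP.
  - move=> r s t /asboolP rs /asboolP st; apply/asboolP => x.
    exact: le_trans (rs x).
  - move=> [s ?] [t ?] /asboolP/= st /asboolP/= ts; apply: eq_exist; apply/funext => x.
    by apply/eqP; rewrite eq_le st ts.
  - move=> A totA; have [->|/set0P[t0 At0]] := eqVneq A set0.
      by exists (exist _ q (conj sq (fun=> lexx _))).
    pose B := [set sval t | t in A].
    have B0 : B !=set0 by exists (sval t0), t0.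
    have totB : total_on B (fun p p' => forall x, p' x <= p x).
      move=> _ _ [s As <-] [t At <-].
      by have [/asboolP|/asboolP] := totA _ _ As At; [left|right].
    have Bsub p : B p -> sublinear p /\ forall x, p x <= q x.
      by move=> [t At <-]; exact: (svalP t).
    have [sI leI] := pointwise_inf_sublinear B0 totB Bsub.
    have Iq x : pointwise_inf B x <= q x.
      by apply: (le_trans (leI (sval t0) _ x)); [exists t0|case: (svalP t0)].
    exists (exist _ (pointwise_inf B) (conj sI Iq)) => s As /=.
    by apply/asboolP; apply: leI; exists s.
exists p => //; apply: minimal_sublinear_linear => // p' sp' p'p.
have p'q x : p' x <= q x by apply: le_trans (pq x).
have /= := pmin (exist _ p' (conj sp' p'q)).
by move=> /(_ (asboolT p'p)) [].
Qed.

End hahn_banach.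

(** * Almost invariant measures on amenable groups *)

(** Only a left inverse of [c] is asked for, so finite groups are included; off the range of [c],
    [d] takes the default value 1. *)
Lemma countable_enum (G : groupType) : countable [set: G] ->
  exists (c : G -> nat) (d : nat -> G), cancel c d.
Proof.
move=> /countable_injP[c cinj].
have {}cinj : injective c by move=> x y; apply: cinj; rewrite inE.
exists c; exists (fun n => xget 1%g [set x | c x = n]) => x.
by case: xgetP => [y _ /cinj//|/(_ x)/= cx]; exfalso; exact: cx.
Qed.

(** A finitely supported nonnegative measure on [A], as a list of weighted points, repetitions
    allowed. *)
Definition cone_seq (R : realType) (T : Type) (A : set T) : pred (seq (R * T)) :=
  all (fun i => (0 <= i.1) && (i.2 \in A)).

(** * Separation of a convex set from the origin *)

Section separation.
Context (R : realType) (V : lmodType R) (nrm : V -> R).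
Hypotheses (nrm_sub : sublinear nrm) (nrmN : forall v, nrm (- v) = nrm v).
Context (T : Type) (A : set T) (k : T -> V) (e : R).

Let mass (s : seq (R * T)) := \sum_(i <- s) i.1.
Let comb (s : seq (R * T)) := \sum_(i <- s) i.1 *: k i.2.

(** Hahn-Banach is applied to [inf_s nrm (v + comb s) - e * mass s], which [far] bounds below by
    [- nrm v]. Empty [s] gives [phi <= nrm]; unit mass at [t] with [v = - k t] gives
    [- phi (k t) <= - e]. *)
Lemma separation :
  (forall s, cone_seq A s -> e * mass s <= nrm (comb s)) ->
  exists phi : V -> R, [/\ forall a x y, phi (a *: x + y) = a * phi x + phi y,
    forall v, phi v <= nrm v & forall t, A t -> e <= phi (k t)].
Proof.
move=> far; pose S v := [set nrm (v + comb s) - e * mass s | s in [set s | cone_seq A s]].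
have hasinf v : has_inf (S v).
  split; first by exists (nrm (v + comb [::]) - e * mass [::]), [::].
  exists (- nrm v) => _ [s /= sA <-].
  have := nrm_sub.1 (v + comb s) (- v); rewrite addrAC subrr add0r nrmN.
  have := far _ sA; lra.
have infle v s : cone_seq A s -> inf (S v) <= nrm (v + comb s) - e * mass s.
  by move=> sA; apply: ge_inf; [case: (hasinf v)|exists s].
have qnrm v : inf (S v) <= nrm v.
  by have := infle v [::] isT; rewrite /comb /mass !big_nil mulr0 addr0 subr0.
have sub : sublinear (fun v => inf (S v)).
  apply: sublinearI.
  - move=> z w; apply/ler_addgt0Pr => d d0.
    have d20 : 0 < d / 2 by rewrite divr_gt0.
    have [_ [t /= tA <-] tz] := inf_adherent d20 (hasinf z).
    have [_ [s /= sA <-] sw] := inf_adherent d20 (hasinf w).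
    have tsA : cone_seq A (t ++ s) by rewrite /cone_seq all_cat; apply/andP.
    apply: (le_trans (infle _ _ tsA)).
    have := nrm_sub.1 (z + comb t) (w + comb s).
    rewrite addrACA /comb /mass !big_cat/= mulrDr -/(comb _) -/(comb _).
    rewrite -/(mass _) -/(mass _); lra.
  - move=> a z a0; rewrite -ler_pdivrMl//; apply: lb_le_inf; first by case: (hasinf z).
    move=> _ [t /= tA <-]; rewrite ler_pdivrMl//.
    pose t' := [seq (a * i.1, i.2) | i <- t].
    have t'A : cone_seq A t'.
      move: tA; rewrite /cone_seq /t' all_map; apply: sub_all => i /= /andP[i0 ->].
      by rewrite mulr_ge0// ltW.
    apply: (le_trans (infle _ _ t'A)).
    have -> : comb t' = a *: comb t.
      by rewrite /comb big_map scaler_sumr; apply: eq_bigr => i _; rewrite scalerA.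
    have -> : mass t' = a * mass t by rewrite /mass big_map mulr_sumr.
    by rewrite -scalerDr nrm_sub.2 ?(ltW a0)// mulrBr mulrCA.
  - apply/eqP; rewrite eq_le; apply/andP; split.
      by have := qnrm 0; rewrite (sublinear0 nrm_sub).
    apply: lb_le_inf; first by case: (hasinf 0).
    by move=> _ [t /= tA <-]; rewrite add0r subr_ge0 far.
have [phi lin phiq] := hahn_banach sub.
exists phi; split=> // [v|t At]; first exact: le_trans (qnrm v).
have phi0 : phi 0 = 0 by have := lin 1 0 0; rewrite scale1r addr0; lra.
have phiN : phi (- k t) = - phi (k t).
  by have := lin (-1) (k t) 0; rewrite addr0 scaleN1r phi0; lra.
have tA : cone_seq A [:: (1 : R, t)] by rewrite /cone_seq /= ler01 mem_set.
have := infle (- k t) _ tA; rewrite /comb /mass !big_seq1/= scale1r addNr.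
rewrite (sublinear0 nrm_sub); have := phiq (- k t); rewrite phiN; lra.
Qed.

End separation.

(* Polynomials serve as finitely supported sequences, with their l1 norm and the
   pairing with bounded sequences. *)
Section poly_l1.
Context (R : realType).
Implicit Types (p q : {poly R}) (u : nat -> R).

Definition poly_l1 p := \sum_(i < size p) `|p`_i|.
Definition poly_pair u p := \sum_(i < size p) p`_i * u i.

Lemma poly_l1_widen p n : (size p <= n)%N -> poly_l1 p = \sum_(i < n) `|p`_i|.
Proof.
move=> pn; rewrite /poly_l1 (big_ord_widen _ (fun i => `|p`_i|) pn).
rewrite big_mkcond/=; apply: eq_bigr => i _; case: ifPn => //.
by rewrite -leqNgt => /(nth_default 0) ->; rewrite normr0.
Qed.

Lemma poly_pair_widen u p n : (size p <= n)%N ->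
  poly_pair u p = \sum_(i < n) p`_i * u i.
Proof.
move=> pn; rewrite /poly_pair (big_ord_widen _ (fun i => p`_i * u i) pn).
rewrite big_mkcond/=; apply: eq_bigr => i _; case: ifPn => //.
by rewrite -leqNgt => /(nth_default 0) ->; rewrite mul0r.
Qed.

Lemma poly_l1_sublinear : sublinear poly_l1.
Proof.
split=> [p q|a p a0].
  have pn := leq_maxl (size p) (size q); have qn := leq_maxr (size p) (size q).
  rewrite (poly_l1_widen pn) (poly_l1_widen qn) (poly_l1_widen (size_polyD p q)).
  by rewrite -big_split/=; apply: ler_sum => i _; rewrite coefD ler_normD.
rewrite (poly_l1_widen (size_scale_leq a p)) mulr_sumr; apply: eq_bigr => i _.
by rewrite coefZ normrM ger0_norm.
Qed.

Lemma poly_l1N p : poly_l1 (- p) = poly_l1 p.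
Proof. by rewrite /poly_l1 size_polyN; apply: eq_bigr => i _; rewrite coefN normrN. Qed.

Lemma poly_l1Xn n : poly_l1 'X^n = 1.
Proof.
rewrite /poly_l1 size_polyXn big_ord_recr/= coefXn eqxx normr1 big1 ?add0r// => i _.
by rewrite coefXn ltn_eqF// normr0.
Qed.

Lemma poly_pairP u a p q : poly_pair u (a *: p + q) = a * poly_pair u p + poly_pair u q.
Proof.
have pn := leq_maxl (size p) (size q); have qn := leq_maxr (size p) (size q).
have apqn : (size (a *: p + q)%R <= maxn (size p) (size q))%N.
  apply: (leq_trans (size_polyD _ _)); rewrite geq_max leq_maxr andbT.
  exact: leq_trans (size_scale_leq a p) pn.
rewrite (poly_pair_widen u pn) (poly_pair_widen u qn) (poly_pair_widen u apqn).
rewrite mulr_sumr -big_split/=; apply: eq_bigr => i _.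
by rewrite coefD coefZ mulrDl mulrA.
Qed.

Lemma poly_pairXn u n : poly_pair u 'X^n = u n.
Proof.
rewrite /poly_pair size_polyXn big_ord_recr/= coefXn eqxx mul1r big1 ?add0r// => i _.
by rewrite coefXn ltn_eqF// mul0r.
Qed.

Lemma poly_pair_le u p : (forall i, `|u i| <= 1) -> `|poly_pair u p| <= poly_l1 p.
Proof.
move=> u1; apply: (le_trans (ler_norm_sum _ _ _)); apply: ler_sum => i _.
by rewrite normrM ler_piMr.
Qed.

HB.instance Definition _ u := GRing.isLinear.Build R {poly R} R *%R (poly_pair u)
  (poly_pairP u).

End poly_l1.

(** * From invariant means to almost invariant finitely supported measures *)

Section amenable_groups.
Context (R : realType) (G : groupType) (countableG : countable [set: G]).
Context (N : set G) (subN : is_subgroup N) (amenN : amenable R N).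

Lemma bounded_on_of_le (h : G -> R) (M : R) : (forall x, `|h x| <= M) ->
  [bounded h x | x in N].
Proof.
move=> hM; exists M; split; first exact: num_real.
by move=> K MK x _; apply: le_trans (hM x) (ltW MK).
Qed.

(** Invariance cancels each summand; the induction carries bounds along because the mean is linear
    on bounded functions only. *)
Lemma mean_translation_sum (m : (G -> R) -> R) (n : nat) (f : nat -> G)
    (g : nat -> G -> R) :
  is_invariant_mean N m -> (forall j, (j < n)%N -> N (f j)) ->
  (forall j x, `|g j x| <= 1) ->
  m (fun x => \sum_(j < n) (g j (f j * x)%g - g j x)) = 0.
Proof.
move=> mP; elim: n => [|n IH] fN g1.
  have b0 : [bounded (0 : R) | x in N].
    by apply: (@bounded_on_of_le (fun=> 0) 0) => x; rewrite normr0.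
  have := mean_linear mP 1 b0 b0; rewrite mul1r addr0.
  under [fun _ : G => \sum_(j < 0) _]funext do rewrite big_ord0.
  lra.
have bg h : [bounded g n (h * x)%g | x in N].
  by apply: (@bounded_on_of_le (fun x => g n (h * x)%g) 1) => x; exact: g1.
have bg1 : [bounded g n x | x in N] by apply: (@bounded_on_of_le _ 1) => x; exact: g1.
have bs : [bounded \sum_(j < n) (g j (f j * x)%g - g j x) | x in N].
  apply: (@bounded_on_of_le _ (\sum_(j < n) 2)) => x.
  apply: (le_trans (ler_norm_sum _ _ _)); apply: ler_sum => j _.
  by apply: (le_trans (ler_normB _ _)); have := g1 j x; have := g1 j (f j * x)%g; lra.
have bd : [bounded - 1 * g n x + g n (f n * x)%g | x in N].
  apply: (@bounded_on_of_le _ 2) => x; rewrite mulN1r addrC.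
  by apply: (le_trans (ler_normB _ _)); have := g1 n x; have := g1 n (f n * x)%g; lra.
under [fun _ : G => _]funext => x.
  rewrite big_ord_recr/= -[X in X + _]mul1r.
  rewrite (_ : g n (f n * x)%g - g n x = - 1 * g n x + g n (f n * x)%g); last by lra.
  over.
rewrite (mean_linear mP)// IH//; last by move=> j jn; apply: fN; rewrite ltnS ltnW.
rewrite (mean_linear mP)//.
(* Invariance is stated for [h^-1 * x], so it is used at [h = (f n)^-1]. *)
have NfV : N (f n)^-1%g.
  by apply/set_mem/(group_closedV subN)/mem_set/fN.
have := mean_invariant mP NfV bg1; rewrite invgK => ->.
lra.
Qed.

(** The vector [k x] collects the differences of point masses at [f j * x] and [x] for all [j] at
    once. If the convex combinations of the [k x] stayed at distance [e] from 0, a separating [phi]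
    would give a function at least [e] on [N] whose mean is 0. Otherwise a combination of small
    norm, normalised, is the measure sought. *)
Lemma amenable_almost_invariant (F : seq G) (e : R) : (forall h, h \in F -> N h) -> 0 < e ->
  exists s : seq (R * G), [/\ cone_seq N s, \sum_(i <- s) i.1 = 1 &
    forall h, h \in F -> forall u : G -> R, (forall x, `|u x| <= 1) ->
      `|\sum_(i <- s) i.1 * (u (h * i.2)%g - u i.2)| <= e].
Proof.
move=> FN e0; have [m mP] := amenN.
have [c [d cK]] := countable_enum countableG.
(* Each index [j] of [F] gets its own copy of [G] among the monomials, so differences for distinct
   [j] cannot cancel. *)
pose code (j : nat) (x : G) := pickle (j, c x).
pose f j := nth 1%g F j.
pose k x : {poly R} := \sum_(j < size F) ('X^(code j (f j * x)%g) - 'X^(code j x)).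
have [far|near] := pselect (forall s : seq (R * G), cone_seq N s ->
    e * \sum_(i <- s) i.1 <= poly_l1 (\sum_(i <- s) i.1 *: k i.2)).
  have [phi [lin phi1 phik]] :=
    separation (poly_l1_sublinear R) (@poly_l1N R) far.
  have phi0 : phi 0 = 0 by have := lin 1 0 0; rewrite scale1r addr0; lra.
  have phiN v : phi (- v) = - phi v.
    by have := lin (-1) v 0; rewrite addr0 scaleN1r phi0; lra.
  have phiD v w : phi (v + w) = phi v + phi w by rewrite -{1}[v]scale1r lin mul1r.
  pose g j x := phi 'X^(code j x).
  have g1 j x : `|g j x| <= 1.
    by rewrite ler_norml lerNl -phiN !(le_trans (phi1 _))// ?poly_l1N poly_l1Xn.
  have phikE x : phi (k x) = \sum_(j < size F) (g j (f j * x)%g - g j x).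
    by rewrite /k (big_morph phi phiD phi0); apply: eq_bigr => j _; rewrite phiD phiN.
  have fN j : (j < size F)%N -> N (f j) by move=> jF; apply: FN; rewrite mem_nth.
  have := mean_translation_sum mP fN g1.
  have b1 : [bounded (1 : R) | x in N].
    by apply: (@bounded_on_of_le (fun=> 1) 1) => x; rewrite normr1.
  have bk : [bounded phi (k x) | x in N].
    apply: (@bounded_on_of_le _ (\sum_(j < size F) 2)) => x; rewrite phikE.
    apply: (le_trans (ler_norm_sum _ _ _)); apply: ler_sum => j _.
    by apply: (le_trans (ler_normB _ _)); have := g1 j x; have := g1 j (f j * x)%g; lra.
  under [fun _ : G => _]funext do rewrite -phikE.
  have := mean_linear mP (- e) b1 bk; rewrite (mean_one mP) => mE mk0.
  (* By linearity this mean equals [- e], the contradiction. *)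
  have : 0 <= m (fun x => - e * 1 + phi (k x)).
    apply: (mean_pos mP) => [|x Nx]; last by have := phik _ Nx; lra.
    apply: (@bounded_on_of_le _ (e + \sum_(j < size F) 2)) => x.
    apply: (le_trans (ler_normD _ _)); apply: lerD.
      by rewrite mulr1 normrN gtr0_norm.
    rewrite phikE.
    apply: (le_trans (ler_norm_sum _ _ _)); apply: ler_sum => j _.
    by apply: (le_trans (ler_normB _ _)); have := g1 j x; have := g1 j (f j * x)%g; lra.
  by rewrite mE mk0; lra.
move: near => /existsNP[s /not_implyP[sN /negP]]; rewrite -ltNge => near.
set C := \sum_(i <- s) i.1 in near.
have C0 : 0 < C.
  have : 0 < e * C by apply: le_lt_trans near; apply: sumr_ge0.
  by rewrite pmulr_rgt0.
exists [seq (C^-1 * i.1, i.2) | i <- s]; split.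
- move: sN; rewrite /cone_seq all_map; apply: sub_all => i /= /andP[i0 ->].
  by rewrite mulr_ge0// invr_ge0 ltW.
- by rewrite big_map/= -mulr_sumr mulVf// gt_eqF.
move=> h hF u u1; rewrite big_map/=.
(* The function [u] placed on the copy of [G] belonging to [h] and 0 on the others; its pairing with
   [k x] is the single difference for [h]. *)
pose U n := if unpickle n is Some (j, n') then
              if j == index h F then u (d n') else 0 else 0 : R.
have U1 i : `|U i| <= 1.
  rewrite /U; case: unpickle => [[j n]|]; last by rewrite normr0.
  by case: ifP => _; rewrite ?normr0.
have Ucode j x : U (code j x) = if j == index h F then u x else 0.
  by rewrite /U /code pickleK/= cK.
have Uk x : poly_pair U (k x) = u (h * x)%g - u x.
  rewrite /k linear_sum/= (bigD1 (Ordinal (_ : (index h F < size F)%N)))/= ?index_mem//.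
  move=> idx; rewrite linearB/= !poly_pairXn !Ucode eqxx /f nth_index//.
  rewrite big1 ?addr0// => j; rewrite -val_eqE/= => /negbTE jh.
  by rewrite linearB/= !poly_pairXn !Ucode jh subrr.
under eq_bigr do rewrite -mulrA -Uk.
rewrite -mulr_sumr normrM gtr0_norm ?invr_gt0// ler_pdivrMl// mulrC.
apply: le_trans (ltW near); apply: le_trans (poly_pair_le _ U1).
by rewrite linear_sum/=; under [X in _ <= `|X|]eq_bigr do rewrite linearZ/=.
Qed.

End amenable_groups.

(** * Averages over a countable discrete group *)

Section discrete_integral.
Context (R : realType) (G : groupType) (countableG : countable [set: G]).
Implicit Types (nu mu : probability (discr G) R) (f : discr G -> R).

Lemma measurable_discr d (T : measurableType d) (f : discr G -> T) :
  measurable_fun setT f.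
Proof. by []. Qed.

(** The fibres of an injection into [nat] partition [G] into countably many sets with at most one
    point. *)
Lemma ge0_integral_discr nu f : (forall x, 0 <= f x) ->
  (\int[nu]_x (f x)%:E = \esum_(x in [set: discr G]) ((f x)%:E * nu [set x]))%E.
Proof.
move=> f0; have /countable_injP[c cinj] := countableG.
pose F i : set (discr G) := c @^-1` [set i].
have tF : trivIset setT F by move=> i j _ _ [x [<- <-]].
have UF : \bigcup_i F i = setT by apply/seteqP; split => // x _; exists (c x).
have a0 x : (0 <= (f x)%:E * nu [set x])%E by rewrite mule_ge0// lee_fin.
rewrite -{1 2}UF ge0_integral_bigcup//=; last by move=> x _; rewrite lee_fin.
rewrite esum_bigcupT// nneseries_esumT; last first.
  by move=> i; apply: integral_ge0 => x _; rewrite lee_fin.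
apply: eq_esum => i _.
have [->|/set0P[x Fx]] := eqVneq (F i) set0; first by rewrite integral_set0 esum_set0.
have -> : F i = [set x].
  by apply/seteqP; split=> [y Fy|_ ->//]; apply: cinj; rewrite ?inE//; rewrite Fx Fy.
rewrite esum_set1// (eq_integral (cst (f x)%:E)) ?integral_cst// => y.
by rewrite inE => ->.
Qed.

Lemma discr_integrable nu f (M : R) : (forall x, `|f x| <= M) ->
  nu.-integrable setT (EFin \o f).
Proof.
move=> fM; apply: measurable_bounded_integrable => //.
  by rewrite -ge0_fin_numE ?fin_num_measure.
by exists M; split=> [|K MK x _]; [exact: num_real|exact: le_trans (fM x) (ltW MK)].
Qed.

Definition avg nu (f : G -> R) : R := Rintegral nu setT f.

Lemma avgD nu f g (M K : R) : (forall x, `|f x| <= M) -> (forall x, `|g x| <= K) ->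
  avg nu (fun x => f x + g x) = avg nu f + avg nu g.
Proof. by move=> fM gK; apply: RintegralD => //; exact: discr_integrable. Qed.

Lemma avgB nu f g (M K : R) : (forall x, `|f x| <= M) -> (forall x, `|g x| <= K) ->
  avg nu (fun x => f x - g x) = avg nu f - avg nu g.
Proof. by move=> fM gK; apply: RintegralB => //; exact: discr_integrable. Qed.

Lemma avg_cst nu (r : R) : avg nu (fun=> r) = r.
Proof.
rewrite /avg Rintegral_cst// -[RHS]mulr1; congr (_ * _).
exact: (congr1 fine (probability_setT nu)).
Qed.

Lemma avg_le nu f g (M K : R) : (forall x, `|f x| <= M) -> (forall x, `|g x| <= K) ->
  (forall x, f x <= g x) -> avg nu f <= avg nu g.
Proof.
by move=> fM gK fg; apply: le_Rintegral => //; exact: discr_integrable.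
Qed.

Lemma avg_norm_le nu f (M : R) : (forall x, `|f x| <= M) -> `|avg nu f| <= M.
Proof.
move=> fM; have cM (x : discr G) : `|M| <= `|M| by [].
have cNM (x : discr G) : `|- M| <= `|M| by rewrite normrN.
rewrite ler_norml; apply/andP; split.
  rewrite -[leLHS](avg_cst nu); apply: (avg_le _ cNM fM) => x.
  by have := fM x; rewrite ler_norml => /andP[].
rewrite -[leRHS](avg_cst nu); apply: (avg_le _ fM cM) => x.
exact: le_trans (ler_norm _) (fM x).
Qed.

Lemma EFin_avg nu f (M : R) : (forall x, `|f x| <= M) ->
  ((avg nu f)%:E = \int[nu]_x (f x)%:E)%E.
Proof.
move=> fM; rewrite /avg /Rintegral fineK//.
exact: integrable_fin_num (discr_integrable nu fM).
Qed.

(** Passing to [h = f + 1], with values between 0 and 2, turns both averages into sums of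
    nonnegative terms; the factor 2 is the bound on [h]. *)
Lemma avg_l1_ball nu mu (d : R) f : l1_ball nu d mu -> (forall x, `|f x| <= 1) ->
  avg nu f <= avg mu f + 2 * d.
Proof.
move=> numu f1; pose h x := f x + 1.
have h0 x : 0 <= h x by have := f1 x; rewrite ler_norml /h; lra.
have h2 x : `|h x| <= 2 by rewrite ger0_norm//; have := f1 x; rewrite ler_norml /h; lra.
have n1 (x : discr G) : `|1 : R| <= 1 by rewrite normr1.
have hE nu' : avg nu' h = avg nu' f + 1 by rewrite (avgD _ f1 n1) avg_cst.
clear n1.
suff : avg nu h <= avg mu h + 2 * d by rewrite !hE (addrAC _ 1) lerD2r.
rewrite -lee_fin EFinD !(EFin_avg _ h2) !ge0_integral_discr//.
have le0 x (t : probability (discr G) R) : (0 <= (h x)%:E * t [set x])%E.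
  by rewrite mule_ge0// lee_fin.
apply: (@le_trans _ _ (\esum_(x in [set: discr G])
    ((h x)%:E * mu [set x] +
     (`|nu [set x] - mu [set x]| + `|nu [set x] - mu [set x]|)))%E).
  apply: le_esum => x _.
  have fin t : (t : probability (discr G) R) [set x] \is a fin_num by exact: fin_num_measure.
  rewrite -[nu _]fineK ?fin// -[mu _]fineK ?fin//= -!EFinM -!EFinD lee_fin.
  have hx2 : 0 <= 2 - h x by rewrite subr_ge0 (le_trans (ler_norm _)).
  move: (fine _) (fine _) => b a.
  have abn : 0 <= `|a - b| - (a - b) by rewrite subr_ge0 ler_norm.
  have := mulr_ge0 hx2 (normr_ge0 (a - b)); have := mulr_ge0 (h0 x) abn.
  lra.
rewrite esumD//; last by move=> x _; rewrite adde_ge0.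
apply: leeD => //; rewrite esumD// mulr_natl EFinD.
by apply: leeD; exact: ltW.
Qed.

End discrete_integral.

(** * Convex combinations of probability measures *)

Section combinations.
Context (R : realType) (G : groupType).
Implicit Types (nu mu : probability (discr G) R).

Lemma convex_combination (n : nat) (c : nat -> R) (p : nat -> probability (discr G) R) :
  (forall i, 0 <= c i) -> \sum_(i < n) c i = 1 ->
  exists mu : probability (discr G) R,
    (forall A, mu A = (\sum_(i < n) (c i)%:E * p i A)%E) /\
    (forall (f : G -> R) M, (forall x, `|f x| <= M) ->
      avg mu f = \sum_(i < n) c i * avg (p i) f).
Proof.
move=> c0 c1.
pose m_ i : {measure set (discr G) -> \bar R} := mscale (NngNum (c0 i)) (p i).
pose m : {measure set (discr G) -> \bar R} := msum m_ n.
have mE A : m A = (\sum_(i < n) (c i)%:E * p i A)%E by [].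
have m1 : m setT = 1%E.
  rewrite mE -[RHS]/(1%:E) -c1 -sumEFin; apply: eq_bigr => i _.
  by rewrite probability_setT mule1.
pose mP := Measure_isProbability.Build _ _ _ m m1.
pose mu : probability (discr G) R := HB.pack (Measure.sort m) mP.
exists mu; split=> // f M fM.
(* Additivity of the integral in the measure is applied to a nonnegative function; the constant [M]
   cancels since the weights sum to 1. *)
pose h x := f x + M.
have h0 x : 0 <= h x by have := fM x; rewrite ler_norml /h; lra.
have hM x : `|h x| <= M + M by rewrite ger0_norm// /h lerD2r (le_trans (ler_norm _)).
have cM (x : G) : `|M| <= `|M| by [].
have hE nu : avg nu h = avg nu f + M by rewrite (avgD _ fM cM) avg_cst.
suff : avg mu h = \sum_(i < n) c i * avg (p i) h.
  rewrite hE; under eq_bigr do rewrite hE mulrDr.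
  by rewrite big_split/= -mulr_suml c1 mul1r => /addIr.
apply: EFin_inj; rewrite (EFin_avg _ hM) -sumEFin.
transitivity (\sum_(i < n) \int[m_ i]_x (h x)%:E)%E.
  rewrite -ge0_integral_measure_sum//.
  by move=> x _; rewrite lee_fin.
apply: eq_bigr => i _; rewrite EFinM (EFin_avg _ hM) ge0_integral_mscale//.
by move=> x _; rewrite lee_fin.
Qed.

Lemma mixture nu mu (d : R) : 0 <= d <= 1 ->
  exists xi : probability (discr G) R,
    (forall A, xi A = ((1 - d)%:E * nu A + d%:E * mu A)%E) /\
    (forall (f : G -> R) M, (forall x, `|f x| <= M) ->
      avg xi f = (1 - d) * avg nu f + d * avg mu f).
Proof.
move=> /andP[d0 d1].
pose c i := if i == 0%N then 1 - d else d.
have [||xi [xiA xif]] := @convex_combination 2 c (fun i => if i == 0%N then nu else mu).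
- by move=> i; rewrite /c; case: ifP => // _; rewrite subr_ge0.
- by rewrite !big_ord_recl big_ord0 /c/= addr0 subrK.
exists xi; split=> [A|f M fM].
  by rewrite xiA !big_ord_recl big_ord0 /c/= adde0.
by rewrite (xif _ _ fM) !big_ord_recl big_ord0 /c/= addr0.
Qed.

Lemma finitely_supported (s : seq (R * G)) : cone_seq setT s -> \sum_(i <- s) i.1 = 1 ->
  exists mu : probability (discr G) R, forall (f : G -> R) M, (forall x, `|f x| <= M) ->
    avg mu f = \sum_(i <- s) i.1 * f i.2.
Proof.
move=> s0 s1; pose t i := nth (0, 1%g) s i.
have [||mu [_ muf]] := @convex_combination (size s) (fun i => (t i).1)
    (fun i => dirac ((t i).2 : discr G) : probability (discr G) R).
(* Beyond the end of the list the default weight is 0. *)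
- move=> i; rewrite /t; have [si|si] := ltnP i (size s); last by rewrite nth_default.
  by have /andP[] := all_nthP (0, 1%g) s0 i si.
- by rewrite -s1 (big_nth (0, 1%g)) big_mkord.
exists mu => f M fM; rewrite (muf _ _ fM) (big_nth (0, 1%g)) big_mkord.
apply: eq_bigr => i _; congr (_ * _).
apply: EFin_inj; rewrite (EFin_avg _ fM) integral_dirac//.
by rewrite diracT mul1e.
Qed.

End combinations.

(** * Genericity of almost invariance *)

Section walk_operator.
Context (R : realType) (G : groupType).
Implicit Types (nu mu : probability (discr G) R) (f : G -> R).

(** The Markov operator of the right random walk: its [n]-th iterate at [g] integrates [f] against
    the translate by [g] of the convolution power [nu^n]. *)
Definition walk_op nu f (g : G) : R := avg nu (fun x => f (g * x)%g).

Lemma iter_walk_op_le nu n f : (forall x, `|f x| <= 1) ->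
  forall x, `|iter n (walk_op nu) f x| <= 1.
Proof.
by move=> f1; elim: n => [//|n IH] x; rewrite iterS; apply: avg_norm_le => y.
Qed.

Lemma iter_walk_op_translate nu n f (g x : G) :
  iter n (walk_op nu) (fun y => f (g * y)%g) x = iter n (walk_op nu) f (g * x)%g.
Proof.
elim: n x => [//|n IH] x; rewrite !iterS /walk_op.
by congr avg; apply/funext => y; rewrite IH mulgA.
Qed.

(** By duality with the unit ball of bounded functions: the [l1] distance between [h nu^n] and
    [nu^n] is at most [e]. *)
Definition almost_invariant nu (h : G) (n : nat) (e : R) :=
  forall f, (forall x, `|f x| <= 1) ->
  `|iter n (walk_op nu) f h - iter n (walk_op nu) f 1%g| <= e.

(* [A k] contains the conjugates of the elements of [A 0] by products of [k]
   elements of the finite set [F] carrying most of [nu]. An increment drawn from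
   [lam] absorbs an element of [A k] at cost [e2]; the other increments only
   conjugate it, except with probability [e1]. *)
Lemma almost_invariant_mixture nu lam xi (d e1 e2 : R) (F : seq G) (A : nat -> seq G) n :
  0 <= d <= 1 -> 0 <= e2 ->
  (forall f M, (forall x, `|f x| <= M) -> avg xi f = (1 - d) * avg nu f + d * avg lam f) ->
  avg nu (fun x => (x \notin F)%:R) <= e1 ->
  (forall k a x, a \in A k -> x \in F -> (a ^ x)%g \in A k.+1) ->
  (forall k a, (k < n)%N -> a \in A k -> forall u : G -> R, (forall x, `|u x| <= 1) ->
     `|avg lam (fun x => u (a * x)%g - u x)| <= e2) ->
  forall k m a, (k + m <= n)%N -> a \in A k ->
  almost_invariant xi a m (2 * (1 - d) ^+ m + m%:R * (2 * e1) + e2).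
Proof.
move=> /andP[d0 d1] e20 xiE nuF AF lamA k m; elim: m k => [|m IH] k a kmn aA u u1.
  rewrite /= expr0 mul0r addr0 mulr1 (le_trans (ler_normB _ _))//.
  by have := u1 a; have := u1 1%g; lra.
have notF1 (x : G) : `|(x \notin F)%:R : R| <= 1.
  by case: (_ \notin _); rewrite ?normr1 ?normr0 ?ler01.
have e10 : 0 <= e1.
  apply: le_trans nuF; rewrite -[leLHS](avg_cst nu).
  by apply: (@avg_le _ _ _ _ _ 1 1) => // y; rewrite normr0 ler01.
set w := iter m (walk_op xi) u.
have w1 x : `|w x| <= 1 by exact: iter_walk_op_le.
pose v x := w (a * x)%g - w x.
have v2 x : `|v x| <= 2.
  by rewrite (le_trans (ler_normB _ _))//; have := w1 (a * x)%g; have := w1 x; lra.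
have -> : iter m.+1 (walk_op xi) u a - iter m.+1 (walk_op xi) u 1%g = avg xi v.
  rewrite !iterS -/w /walk_op -(@avgB _ _ _ _ _ 1 1)//.
  by congr avg; apply/funext => x; rewrite mul1g.
set b := 2 * (1 - d) ^+ m + m%:R * (2 * e1) + e2.
have kn : (k < n)%N by rewrite (leq_trans _ kmn)// -addSnnS leq_addr.
have vF x : `|v x| <= b + 2 * (x \notin F)%:R.
  have b0 : 0 <= b.
    by rewrite !addr_ge0// ?mulr_ge0// exprn_ge0// subr_ge0.
  have [xF|xF] /= := boolP (x \in F); last first.
    by rewrite mulr1 (le_trans (v2 x))// lerDr.
  have kmn' : (k.+1 + m <= n)%N by rewrite addSnnS.
  (* Since [a * x = x * a ^ x] and the operator commutes with left translations, the induction
     hypothesis applies to [a ^ x] and the translate of [u] by [x]. *)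
  have ux1 y : `|u (x * y)%g| <= 1 by [].
  have := IH k.+1 (a ^ x)%g kmn' (AF _ _ _ aA xF) (fun y => u (x * y)%g) ux1.
  by rewrite !iter_walk_op_translate mulg1 -conjgC mulr0 addr0.
have vb : `|avg nu v| <= b + 2 * e1.
  have avE : avg nu (fun x => b + 2 * (x \notin F)%:R) =
      b + 2 * avg nu (fun x => (x \notin F)%:R).
    have cb (x : G) : `|b| <= `|b| by [].
    have c2 (x : G) : `|2 * (x \notin F)%:R : R| <= 2.
      by rewrite normrM ger0_norm// ler_piMr.
    rewrite (avgD _ cb c2) avg_cst; congr (_ + _).
    by rewrite -[2]/(1 + 1) mulrDl mul1r -(avgD _ notF1 notF1); congr avg;
      apply/funext => x; rewrite mulrDl mul1r.
  apply: (@le_trans _ _ (b + 2 * avg nu (fun x => (x \notin F)%:R))); last first.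
    by rewrite lerD2l ler_wpM2l.
  rewrite -avE.
  have bF x : `|b + 2 * (x \notin F)%:R| <= `|b| + 2.
    by rewrite (le_trans (ler_normD _ _))// lerD2l normrM ger0_norm// ler_piMr.
  have vN x : `|- v x| <= 2 by rewrite normrN.
  rewrite ler_norml; apply/andP; split.
    have -> : avg nu v = - avg nu (fun x => - v x).
      have := avgD nu v2 vN; under [fun x : G => v x - v x]funext do rewrite subrr.
      by rewrite avg_cst => /esym/eqP; rewrite addr_eq0 => /eqP.
    rewrite lerN2; apply: (avg_le _ vN bF) => x.
    by have := vF x; rewrite ler_norml lerNl => /andP[].
  by apply: (avg_le _ v2 bF) => x; have := vF x; rewrite ler_norml => /andP[].
rewrite (xiE _ _ v2) (le_trans (ler_normD _ _))// !normrM (ger0_norm d0).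
rewrite (@ger0_norm _ (1 - d)) ?subr_ge0//.
have lv : `|avg lam v| <= e2 by exact: (lamA k a kn aA w w1).
have d1' : 0 <= 1 - d by rewrite subr_ge0.
have := ler_wpM2l d0 lv; have := ler_wpM2l d1' vb.
(* The bound obtained is [(1 - d) * (b + 2 * e1) + d * e2]; this term is its distance to the claimed
   one. *)
have : 0 <= d * ((m%:R + 1) * (2 * e1)) by rewrite !mulr_ge0// addr_ge0.
rewrite exprS -natr1 /b; lra.
Qed.

Context (countableG : countable [set: G]).

(** The law of one increment is exchanged at a time, at cost [2 * d] each. *)
Lemma iter_walk_op_l1_ball nu mu (d : R) f n g : l1_ball nu d mu ->
  (forall x, `|f x| <= 1) ->
  `|iter n (walk_op nu) f g - iter n (walk_op mu) f g| <= n%:R * (2 * d).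
Proof.
move=> numu f1; elim: n g => [g|n IH g]; first by rewrite subrr normr0 mul0r.
rewrite !iterS /walk_op -/(walk_op nu) -/(walk_op mu).
set F := iter n _ _; set H := iter n _ _.
have F1 x : `|F (g * x)%g| <= 1 by exact: iter_walk_op_le.
have H1 x : `|H (g * x)%g| <= 1 by exact: iter_walk_op_le.
have FH := avg_norm_le mu (fun x => IH (g * x)%g).
have := avgB mu F1 H1; rewrite -/F -/H in FH => FHE.
have := avg_l1_ball countableG numu F1.
have := avg_l1_ball countableG (l1_ball_sym numu) F1.
move: FH; rewrite FHE -natr1 !ler_norml; lra.
Qed.

(** The tails [D n] decrease to the empty set, so their mass tends to 0. *)
Lemma finite_set_carrying nu (e : R) : 0 < e ->
  exists F : seq G, avg nu (fun x => (x \notin F)%:R) <= e.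
Proof.
move=> e0; have [c [d cK]] := countable_enum countableG.
pose D n : set (discr G) := [set x | (n <= c x)%N].
have D0 : \bigcap_n D n = set0.
  by apply/seteqP; split => // x /(_ (c x).+1 I); rewrite /D/= ltnn.
have cvgD : nu (D n) @[n --> \oo] --> 0%E.
  rewrite -(@measure0 _ _ _ nu) -D0; apply: nonincreasing_cvg_mu => //.
  - by rewrite -ge0_fin_numE// fin_num_measure.
  - apply/nonincreasing_seqP => n; apply/subsetPset => x; rewrite /D/=; exact: ltnW.
have [n nuD] : exists n, (nu (D n) < e%:E)%E.
  have /fine_cvgP[_] := cvgD.
  move=> /cvgrPdist_lt /(_ e e0)[n _ /(_ n (leqnn n))] /=.
  rewrite sub0r normrN ger0_norm ?fine_ge0// => De; exists n.
  by rewrite -[nu _]fineK ?fin_num_measure// lte_fin.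
exists [seq d i | i <- iota 0 n].
rewrite -lee_fin (EFin_avg _ (M := 1)); last first.
  by move=> x; case: (_ \notin _); rewrite ?normr1 ?normr0 ?ler01.
apply: le_trans (ltW nuD).
rewrite -[D n]setIT -integral_indic//.
apply: ge0_le_integral => // x _.
rewrite lee_fin indicE; have [xF|_] := boolP (x \notin _); last by rewrite ler0n.
rewrite mem_set// /D/= leqNgt; apply: contra xF => cxn.
by rewrite -(cK x) map_f// mem_iota.
Qed.

End walk_operator.

(** * Open and dense conditions on the measure *)

Section genericity.
Context (R : realType) (G : groupType) (countableG : countable [set: G]).
Implicit Types (nu mu : probability (discr G) R) (f : G -> R).

Lemma l1_open (S : set (probability (discr G) R)) :
  (forall nu, S nu -> exists2 d : R, 0 < d & forall mu, l1_ball nu d mu -> S mu) ->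
  open S.
Proof.
move=> SP; rewrite openE => nu /SP[d d0 dS].
by apply/nbhs_ballP; exists d => //= mu /dS.
Qed.

Lemma l1_dense (S : set (probability (discr G) R)) :
  (forall nu (e : R), 0 < e -> exists2 mu, l1_ball nu e mu & S mu) -> dense S.
Proof.
move=> SP O [nu Onu] oO; have /nbhs_ballP[d /= d0 dO] := open_nbhs_nbhs (conj oO Onu).
by have [mu numu Smu] := SP nu d d0; exists mu; split => //; exact: dO.
Qed.

(** Since [nu - xi = d (nu - mu)], the distance is at most [2 * d]. *)
Lemma mixture_l1_ball nu mu (xi : probability (discr G) R) (d e : R) : 0 <= d -> 2 * d < e ->
  (forall A, xi A = ((1 - d)%:E * nu A + d%:E * mu A)%E) -> l1_ball nu e xi.
Proof.
move=> d0 de xiE; rewrite /l1_ball/= /l1_dist.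
apply: (@le_lt_trans _ _ (\esum_(x in [set: discr G])
    ((cst d x)%:E * nu [set x] + (cst d x)%:E * mu [set x]))%E).
  apply: le_esum => x _ /=.
  have fin t : (t : probability (discr G) R) [set x] \is a fin_num by exact: fin_num_measure.
  have ge0 t : 0 <= fine ((t : probability (discr G) R) [set x]) by rewrite fine_ge0.
  rewrite xiE -[nu _]fineK ?fin// -[mu _]fineK ?fin//= -!EFinM -!EFinD lee_fin.
  have := ge0 nu; have := ge0 mu; move: (fine _) (fine _) => a b a0 b0.
  have -> : a - ((1 - d) * a + d * b) = d * a - d * b by ring.
  by rewrite (le_trans (ler_normB _ _))// !ger0_norm// mulr_ge0.
rewrite esumD//; try by move=> x _; rewrite mule_ge0// lee_fin.
have dE t : (\esum_(x in [set: discr G]) ((cst d x)%:E * (t : probability (discr G) R) [set x]) = d%:E)%E.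
  rewrite -ge0_integral_discr//; transitivity (d%:E * t setT)%E.
    exact: (integral_cst t measurableT d%:E).
  by rewrite -[RHS]mule1; congr (_ * _)%E; exact: probability_setT.
by rewrite !dE -EFinD lte_fin; move: de; lra.
Qed.

Lemma open_charged (g : G) : open [set nu : probability (discr G) R | (0 < nu [set g])%E].
Proof.
(* A measure giving [g] no mass is at distance at least [nu [set g]]. *)
apply: l1_open => nu /= nug; exists (fine (nu [set g])).
  by rewrite fine_gt0// nug -ge0_fin_numE// fin_num_measure.
move=> mu; rewrite /l1_ball/= /l1_dist => numu; rewrite lt0e measure_ge0 andbT.
apply/eqP => mug.
have : (nu [set g] <= \esum_(x in [set: discr G]) `|nu [set x] - mu [set x]|)%E.
  apply: esum_ge; exists [set g] => //.
  by rewrite fsbig_set1 mug sube0 gee0_abs.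
by rewrite leNgt (lt_le_trans numu)// fineK// fin_num_measure.
Qed.

Lemma dense_charged (g : G) : dense [set nu : probability (discr G) R | (0 < nu [set g])%E].
Proof.
apply: l1_dense => nu e e0; pose d := Num.min 1 (e / 4).
have d0 : 0 < d by rewrite lt_min ltr01 divr_gt0.
have d1 : d <= 1 by rewrite ge_min lexx.
have de : d <= e / 4 by rewrite ge_min lexx orbT.
have d01 : 0 <= d <= 1 by rewrite ltW.
have [xi [xiE _]] := mixture nu (dirac (g : discr G) : probability (discr G) R) d01.
exists xi; first by apply: (mixture_l1_ball _ _ xiE); [exact: ltW|lra].
rewrite /= xiE [X in (_ + _ * X)%E](_ : _ = 1%E); last first.
  by rewrite [LHS](@diracE _ _ R (g : discr G)) mem_set.
rewrite mule1; apply: (@lt_le_trans _ _ d%:E); first by rewrite lte_fin.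
by rewrite leeDr// mule_ge0// lee_fin subr_ge0.
Qed.

Lemma open_almost_invariant (h : G) (e : R) :
  open [set nu | exists n, exists2 e', e' < e & almost_invariant nu h n e'].
Proof.
(* With [n] kept, the values at [h] and at 1 each move by at most [(e - e') / 4]. *)
apply: l1_open => nu [n [e' e'e inv]]; pose d := (e - e') / (8 * (n%:R + 1)).
have n0 : 0 < 8 * (n%:R + 1) :> R by rewrite mulr_gt0// ltr_wpDl.
have d0 : 0 < d by rewrite divr_gt0// subr_gt0.
exists d => // mu numu; exists n; exists (e' + (e - e') / 2).
  by lra.
move=> f f1.
have := iter_walk_op_l1_ball countableG n h numu f1.
have := iter_walk_op_l1_ball countableG n 1%g numu f1.
have nd : n%:R * (2 * d) <= (e - e') / 4.
  have -> : (e - e') / 4 = 2 * (d * (n%:R + 1)).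
    by rewrite /d; field; lra.
  have := ltW d0; lra.
have := inv f f1; rewrite !ler_norml; lra.
Qed.

(** The order of choices matters: the weight [d] from [r], then the time [n], then the finite set
    [F], and only then [lam], almost invariant under the finitely many conjugates of [h] that these
    produce. *)
Lemma dense_almost_invariant (N : set G) (h : G) (e : R) :
  is_normal_subgroup N -> amenable R N -> N h -> 0 < e ->
  dense [set nu : probability (discr G) R |
    exists n, exists2 e', e' < e & almost_invariant nu h n e'].
Proof.
move=> [subN normN] amenN Nh e0; apply: l1_dense => nu r r0.
pose d := Num.min 2^-1 (r / 4).
have d0 : 0 < d by rewrite lt_min divr_gt0// invr_gt0 ltr0n.
have d1 : d <= 2^-1 by rewrite ge_min lexx.
have dr : d <= r / 4 by rewrite ge_min lexx orbT.
have d01 : 0 <= d <= 1 by rewrite ltW//= (le_trans d1)// invf_le1// ler1n.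
have [n nlt] : exists n, (1 - d) ^+ n < e / 16.
  have d1' : `|1 - d| < 1 by rewrite ger0_norm; lra.
  have /cvgrPdist_lt/(_ (e / 16)) := cvg_expr d1'.
  rewrite divr_gt0// => /(_ isT)[n _ /(_ n (leqnn n))]/=.
  rewrite sub0r normrN ger0_norm ?exprn_ge0//; last by lra.
  by exists n.
pose e1 := e / (16 * (n%:R + 1)).
have n0 : 0 < 16 * (n%:R + 1) :> R by rewrite mulr_gt0// ltr_wpDl.
have e10 : 0 < e1 by rewrite divr_gt0.
have [F nuF] := finite_set_carrying countableG nu e10.
pose A := fix A k := if k is k'.+1 then [seq (a ^ x)%g | a <- A k', x <- F] else [:: h].
have AN k a : a \in A k -> N a.
  elim: k a => [|k IH] a /=; first by rewrite inE => /eqP ->.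
  by move=> /allpairsP[[b x] /= [/IH Nb _ ->]]; exact: normN.
pose B := flatten [seq A k | k <- iota 0 n].
have BN a : a \in B -> N a by move=> /flatten_mapP[k _ /AN].
have e80 : 0 < e / 8 by rewrite divr_gt0.
have [s [sN s1 sinv]] := amenable_almost_invariant countableG subN amenN BN e80.
have [lam lamE] : exists lam : probability (discr G) R, forall (f : G -> R) M,
    (forall x, `|f x| <= M) -> avg lam f = \sum_(i <- s) i.1 * f i.2.
  apply: finitely_supported => //; move: sN; apply: sub_all => i /andP[-> _].
  by rewrite in_setT.
have [xi [xiA xif]] := mixture nu lam d01.
exists xi; first by apply: (mixture_l1_ball _ _ xiA); [exact: ltW|lra].
(* Each of the three terms is at most [e / 8]. *)
exists n; exists (2 * (1 - d) ^+ n + n%:R * (2 * e1) + e / 8).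
  have -> : n%:R * (2 * e1) = (e / 8) * (n%:R / (n%:R + 1)).
    by rewrite /e1; field; lra.
  have : n%:R / (n%:R + 1) <= 1 :> R.
    by rewrite ler_pdivrMr ?mul1r ?lerDl ?ler01// ltr_wpDl.
  move=> /(ler_wpM2l (ltW e80)); lra.
have AF k a x : a \in A k -> x \in F -> (a ^ x)%g \in A k.+1.
  by move=> aA xF /=; apply/allpairsP; exists (a, x).
apply: (almost_invariant_mixture d01 (ltW e80) xif nuF AF _ (leqnn n : (0 + n <= n)%N)).
- move=> k a kn aA u u1.
  rewrite (lamE _ 2).
    apply: sinv => //; apply/flatten_mapP; exists k => //.
    by rewrite mem_iota.
  by move=> x; rewrite (le_trans (ler_normB _ _))//; have := u1 (a * x)%g; have := u1 x; lra.
- by rewrite inE.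
Qed.

End genericity.

(** * Trajectories and shift-invariant events *)

Section path_space.
Context (G : groupType).

Lemma measurable_path d (T : measurableType d) (f : T -> path_space G) :
  (forall n, measurable_fun setT (fun t => f t n : discr G)) -> measurable_fun setT f.
Proof.
move=> mf; apply: (@measurability _ _ T (path_space G) setT f (@cylinders G)) => //.
move=> _ [_ [n [A ->]] <-].
by have := mf n measurableT (A : set (discr G)) I; rewrite !setTI.
Qed.

Lemma measurable_coord n : measurable_fun setT (fun w : path_space G => w n : discr G).
Proof.
move=> _ A _; rewrite setTI; apply: sub_sigma_algebra.
by exists n, A.
Qed.

Lemma measurable_translate (g : G) : measurable_fun setT (@translate G g).
Proof.
apply: measurable_path => n.
exact: (measurableT_comp (measurable_discr (fun x : discr G => (g * x)%g : discr G))
          (measurable_coord n)).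
Qed.

(* The trajectory with first increment [y] whose remaining increments are those
   of [w]. *)
Definition walk_step (y : G) (w : path_space G) : path_space G :=
  fun n => if n is n'.+1 then (y * (w n' : G))%g else y.

Lemma translateM (g h : G) w : translate g (translate h w) = translate (g * h)%g w.
Proof. by apply/funext => n; rewrite /translate mulgA. Qed.

Lemma translate_walk_step g y w : translate g (walk_step y w) = walk_step (g * y)%g w.
Proof. by apply/funext => -[//|n]; rewrite /translate/= mulgA. Qed.

Definition point_cylinder (n : nat) (a : nat -> G) : set (path_space G) :=
  [set w | forall i, (i < n)%N -> w i = a i].

(** The empty set is added for closure under intersection. *)
Definition point_cylinders : set (set (path_space G)) :=
  [set S | S = set0 \/ exists n a, S = point_cylinder n a].

Lemma measurable_point_cylinder n a : measurable (point_cylinder n a).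
Proof.
rewrite (_ : point_cylinder n a =
    \bigcap_(i < n) [set w : path_space G | w i = a i]); last first.
  by apply/seteqP; split.
apply: bigcap_measurableType => // i _.
by have := @measurable_coord i measurableT [set (a i : discr G)] I; rewrite setTI.
Qed.

Lemma point_cylinders_setI : setI_closed point_cylinders.
Proof.
move=> A B [->|[n [a ->]]]; first by rewrite set0I; left.
move=> [->|[m [b ->]]]; first by rewrite setI0; left.
have [->|/set0P[w [wa wb]]] := eqVneq (point_cylinder n a `&` point_cylinder m b) set0.
  by left.
(* Any common trajectory [w] describes the intersection. *)
right; exists (maxn n m), w; apply/seteqP; split => [v [va vb] i|v vw].
  by rewrite leq_max => /orP[im|im]; [rewrite va ?wa|rewrite vb ?wb].
split=> i im; rewrite vw ?leq_max ?im ?orbT//; [exact: wa|exact: wb].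
Qed.

Hypothesis countableG : countable [set: G].

Lemma point_cylinders_generate :
  @measurable _ (path_space G) = <<s point_cylinders >>.
Proof.
have [c [d cK]] := countable_enum countableG.
apply/seteqP; split; last first.
  apply: smallest_sub; first exact: sigma_algebra_measurable.
  by move=> _ [->|[n [a ->]]]; [exact: measurable0|exact: measurable_point_cylinder].
apply: smallest_sub; first exact: smallest_sigma_algebra.
move=> _ [n [A ->]].
(* Lists of codes name the finite words, so the event is a countable union of point cylinders of
   length [n.+1]. *)
pose a (s : seq nat) i := d (nth 0%N s i).
pose F m := if unpickle m is Some s then
  (if `[< A (a s n) >] then point_cylinder n.+1 (a s) else set0) else set0.
have -> : [set w : path_space G | A (w n)] = \bigcup_m F m.
  apply/seteqP; split => [w Aw|w [m _]].
    pose s := mkseq (fun i => c (w i)) n.+1.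
    have as_ i : (i < n.+1)%N -> a s i = w i by move=> im; rewrite /a nth_mkseq// cK.
    exists (pickle s) => //; rewrite /F pickleK as_// asboolT// => i im.
    by rewrite as_.
  rewrite /F; case: unpickle => // s; case: asboolP => // As.
  by move=> ws /=; rewrite ws.
apply: sigma_algebra_bigcup => m; rewrite /F; case: unpickle => [s|].
  case: asboolP => _; last exact: sigma_algebra0.
  by apply: sub_sigma_algebra; right; exists n.+1, (a s).
exact: sigma_algebra0.
Qed.

Lemma path_measure_unique (R : realType) (m1 m2 : {measure set (path_space G) -> \bar R}) :
  (forall n a, m1 (point_cylinder n a) = m2 (point_cylinder n a)) ->
  (m1 setT < +oo)%E ->
  forall E, measurable E -> m1 E = m2 E.
Proof.
move=> m12 m1T E mE.
have cT : point_cylinders setT.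
  by right; exists 0%N, (fun=> 1%g); apply/seteqP; split.
apply: (measure_unique point_cylinders (fun=> setT)) => //.
- exact: point_cylinders_generate.
- exact: point_cylinders_setI.
- by rewrite bigcup_const.
- by move=> _ [->|[n [a ->]]]; rewrite ?measure0.
Qed.

Lemma measurable_uncurry_discr d d' (T : measurableType d) (T' : measurableType d')
    (F : discr G * T -> T') :
  (forall y, measurable_fun setT (fun t => F (y, t))) -> measurable_fun setT F.
Proof.
move=> mF _ A mA; rewrite setTI; have [c [d0 cK]] := countable_enum countableG.
have -> : F @^-1` A = \bigcup_i ([set (d0 i : discr G)] `*` (fun t => F (d0 i, t)) @^-1` A).
  apply/seteqP; split => [[y t] /= Ay|[y t] [i _ [/= -> ]]//].
  by exists (c y) => //; split; rewrite /= cK.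
apply: bigcupT_measurable => i; apply: measurableX => //.
by rewrite -[X in measurable X]setTI; exact: mF.
Qed.

Lemma measurable_walk_step :
  measurable_fun setT (fun z : discr G * path_space G => walk_step z.1 z.2).
Proof.
apply: measurable_uncurry_discr => y /=; apply: measurable_path => -[|n] //=.
exact: (measurableT_comp (measurable_discr (fun x : discr G => (y * x)%g : discr G))
          (measurable_coord n)).
Qed.

End path_space.

(** * The law of the walk and the harmonic functions of invariant events *)

Section walk_distribution.
Context (R : realType) (G : groupType) (countableG : countable [set: G]).
Context (nu : probability (discr G) R) (eta : probability (path_space G) R).
Hypothesis eta_walk : is_walk_distribution nu eta.

(** Index 0 holds the position after the first step, preceded by the identity. *)
Definition increment (a : nat -> G) (i : nat) : G :=
  ((if i is j.+1 then a j else 1)^-1 * a i)%g.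

Lemma walk_point_cylinder n a : eta (point_cylinder n a) =
  (\prod_(i < n) nu [set (increment a i : discr G)])%E.
Proof.
have [d [T [P [X [[lawX indX] etaE]]]]] := eta_walk.
rewrite etaE; last exact: measurable_point_cylinder.
have -> : walk X @^-1` point_cylinder n a =
    \bigcap_(i < n) (X i @^-1` [set (increment a i : discr G)]).
  apply/seteqP; split => t /= Xa i /= im.
    rewrite /increment -(Xa i im) /walk big_nat_recr//=.
    case: i im => [|i] im; first by rewrite big_geq// invg1 !mul1g.
    by rewrite -(Xa i (ltnW im)) /walk mulKg.
  rewrite /walk; elim: i im => [|i IH] im.
    by rewrite big_nat1 (Xa 0%N im) /increment invg1 mul1g.
  by rewrite big_nat_recr//= (IH (ltnW im)) (Xa _ im) /increment mulVKg.
rewrite indX; apply: eq_bigr => i _.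
by have := lawX i [set (increment a i : discr G)].
Qed.

(** The Markov property: [eta] is the image of [nu \x eta] under [walk_step], as both agree on point
    cylinders. *)
Lemma walk_first_step E : measurable E ->
  eta E = (\int[nu]_y eta (walk_step y @^-1` E))%E.
Proof.
move=> mE.
pose m : {measure set (path_space G) -> \bar R} :=
  measure_function_pushforward__canonical__measure_function_Measure
    (nu \x eta)%E (measurable_walk_step countableG).
have mT : (nu \x eta)%E setT = 1%E.
  rewrite -setXTT product_measure1E// -[RHS]mule1.
  by congr (_ * _)%E; exact: probability_setT.
have <- : m E = (\int[nu]_y eta (walk_step y @^-1` E))%E.
  by rewrite /m/= /pushforward /product_measure1; apply: eq_integral => y _ /=; rewrite xsectionE.
apply: path_measure_unique => // [n a|]; last first.
  by rewrite -ge0_fin_numE ?fin_num_measure.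
rewrite /m/= /pushforward; case: n => [|n].
  rewrite (_ : point_cylinder 0 a = setT); last by apply/seteqP.
  by rewrite preimage_setT mT; exact: probability_setT.
pose b i := ((a 0%N)^-1 * a i.+1)%g.
have -> : (fun z : discr G * path_space G => walk_step z.1 z.2) @^-1` point_cylinder n.+1 a =
    [set (a 0%N : discr G)] `*` point_cylinder n b.
  apply/seteqP; split => [[y w] /= ya|[y w] [/= -> wb] [|i] im //=].
    have y0 := ya 0%N isT; split => // i im.
    by rewrite /b -(ya i.+1 im) -y0/= mulKg.
  by rewrite (wb i im) /b mulVKg.
rewrite product_measure1E//; last exact: measurable_point_cylinder.
rewrite walk_point_cylinder big_ord_recl; congr (_ * _)%E.
  by rewrite /increment invg1 mul1g.
rewrite [RHS](walk_point_cylinder n b); apply: eq_bigr => -[[|i] im] _; rewrite /increment /b/=.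
  by rewrite invg1 mul1g.
by rewrite invgM invgK -mulgA mulVKg.
Qed.

Lemma measurable_walk_step_preimage y (E : set (path_space G)) : measurable E -> measurable (walk_step y @^-1` E).
Proof.
move=> mE; have := measurable_walk_step countableG measurableT mE; rewrite setTI.
by move=> /(measurable_xsection (y : discr G)); rewrite xsectionE.
Qed.

Lemma measurable_translate_preimage (g : G) (E : set (path_space G)) :
  measurable E -> measurable (@translate G g @^-1` E).
Proof. by move=> mE; rewrite -[X in measurable X]setTI; exact: measurable_translate. Qed.

(** In the first-step decomposition of [eta F] every term has positive weight, so all of them
    vanish. *)
Lemma walk_step_null F : (forall g : G, (0 < nu [set (g : discr G)])%E) ->
  measurable F -> eta F = 0%E -> forall y, eta (walk_step y @^-1` F) = 0%E.
Proof.
move=> nu0 mF F0 y; have mFy z := measurable_walk_step_preimage z mF.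
have fin z : eta (walk_step z @^-1` F) \is a fin_num by exact: fin_num_measure.
pose f (z : discr G) := fine (eta (walk_step z @^-1` F)).
have f0 z : 0 <= f z by rewrite fine_ge0.
have : (\int[nu]_z (f z)%:E = 0)%E.
  by rewrite -[RHS]F0 (walk_first_step mF); apply: eq_integral => z _; rewrite fineK.
rewrite ge0_integral_discr// => e0.
have : ((f y)%:E * nu [set (y : discr G)] = 0)%E.
  apply/eqP; rewrite eq_le mule_ge0 ?lee_fin// andbT -e0.
  by apply: esum_ge; exists [set y] => //; rewrite fsbig_set1.
move=> /eqP; rewrite mule_eq0 (gt_eqF (nu0 y)) orbF eqe => /eqP fy0.
by rewrite -(fineK (fin y)) -/(f y) fy0.
Qed.

(** Translation by [g] only changes the first increment from [y] to [g * y]. *)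
Lemma translate_null F : (forall g : G, (0 < nu [set (g : discr G)])%E) ->
  measurable F -> eta F = 0%E -> forall g, eta (@translate G g @^-1` F) = 0%E.
Proof.
move=> nu0 mF F0 g.
rewrite (walk_first_step (measurable_translate_preimage g mF)).
rewrite integral0_eq// => y _; rewrite -[RHS](walk_step_null nu0 mF F0 (g * y)%g).
congr (eta _); apply/seteqP; split => w /=; by rewrite translate_walk_step.
Qed.

Definition harmonic (E : set (path_space G)) (g : G) : R :=
  fine (eta (@translate G g @^-1` E)).

Lemma shift_invariant_translate (g : G) (E : set (path_space G)) :
  shift_invariant E -> shift_invariant (@translate G g @^-1` E).
Proof.
move=> [mE sE]; split; first exact: measurable_translate_preimage.
by rewrite -{2}sE.
Qed.

Lemma harmonic_translate E (g h : G) :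
  harmonic (@translate G g @^-1` E) h = harmonic E (g * h)%g.
Proof.
congr (fine (eta _)); apply/seteqP; split => w /=; by rewrite translateM.
Qed.

Lemma harmonic_le1 E (g : G) : measurable E -> `|harmonic E g| <= 1.
Proof.
move=> mE; have mgE := measurable_translate_preimage g mE.
rewrite ger0_norm ?fine_ge0// -lee_fin fineK ?fin_num_measure//.
exact: probability_le1.
Qed.

(** The shift of [walk_step y w] is [translate y w]. *)
Lemma shift_invariant_walk_step y (E : set (path_space G)) w : shift_invariant E ->
  E (walk_step y w) <-> E (translate y w).
Proof. by move=> [_ sE]; rewrite -{1}sE. Qed.

Lemma walk_op_harmonic E : shift_invariant E -> walk_op nu (harmonic E) = harmonic E.
Proof.
move=> sE; have [mE _] := sE; apply/funext => g.
have h1 x : `|harmonic E (g * x)%g| <= 1 by exact: harmonic_le1.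
apply: EFin_inj; rewrite (EFin_avg _ h1).
have mgE := measurable_translate_preimage g mE.
rewrite /harmonic fineK ?fin_num_measure// (walk_first_step mgE).
apply: eq_integral => y _; rewrite fineK; last first.
  by apply: fin_num_measure; exact: measurable_translate_preimage.
congr (eta _); apply/seteqP; split => w /=; rewrite translate_walk_step.
  by move=> /(shift_invariant_walk_step _ _ sE).
by move=> /(shift_invariant_walk_step _ _ sE).
Qed.

(* By the Markov property, [eta (C `&` E)] for a point cylinder [C] only depends
   on the harmonic function of [E]. *)
Lemma harmonic_determines E E' : shift_invariant E -> shift_invariant E' ->
  harmonic E = harmonic E' ->
  forall A, measurable A -> eta (A `&` E) = eta (A `&` E').
Proof.
move=> sE sE' hEE' A mA; have [mE _] := sE; have [mE' _] := sE'.
suff cyl n a : eta (point_cylinder n a `&` E) = eta (point_cylinder n a `&` E').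
  apply: (@path_measure_unique _ countableG _ (mrestr eta mE) (mrestr eta mE')) => //.
  by rewrite /= /mrestr -ge0_fin_numE// fin_num_measure//; apply: measurableI.
(* The events are generalised because the first step replaces them by their translates. *)
elim: n a E E' sE sE' hEE' {mE mE'} => [|n IH] a E E' sE sE' hEE'.
  have -> : point_cylinder 0 a = setT by apply/seteqP.
  have [mE _] := sE; have [mE' _] := sE'.
  rewrite !setTI -(fineK (fin_num_measure eta _ mE)) -(fineK (fin_num_measure eta _ mE')).
  have t1 F : @translate G 1%g @^-1` F = F.
    by apply/seteqP; split => w /=; rewrite (_ : translate 1%g w = w)//;
      apply/funext => i; rewrite /translate mul1g.
  have := congr1 (@^~ 1%g) hEE'; by rewrite /harmonic !t1 => ->.
have mC F : shift_invariant F -> measurable (point_cylinder n.+1 a `&` F).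
  by move=> [mF _]; apply: measurableI => //; exact: measurable_point_cylinder.
rewrite (walk_first_step (mC _ sE)) (walk_first_step (mC _ sE')); apply: eq_integral => y _.
have [ya|ya] := eqVneq y (a 0%N); last first.
  suff e0 F : walk_step y @^-1` (point_cylinder n.+1 a `&` F) = set0 by rewrite !e0.
  by apply/seteqP; split => // w [/(_ 0%N isT)/= /eqP]; rewrite (negbTE ya).
pose b i := (y^-1 * a i.+1)%g.
have step F : shift_invariant F -> walk_step y @^-1` (point_cylinder n.+1 a `&` F) =
    point_cylinder n b `&` (@translate G y @^-1` F).
  move=> sF; apply/seteqP; split => w /= [wa wF]; split.
  - by move=> i im; rewrite /b -(wa i.+1 im)/= mulKg.
  - exact/(shift_invariant_walk_step _ _ sF).
  - by move=> [_|i im] //=; rewrite (wa i im) /b mulVKg.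
  - exact/(shift_invariant_walk_step _ _ sF).
rewrite !step//; apply: IH; [exact: shift_invariant_translate..|].
by apply/funext => g; rewrite !harmonic_translate hEE'.
Qed.

(** The operator fixes [harmonic E], so its iterates drop out of the almost invariance, whatever [n]
    is. *)
Lemma harmonic_almost_invariant E h : shift_invariant E ->
  (forall e : R, 0 < e -> exists n, exists2 e', e' < e & almost_invariant nu h n e') ->
  harmonic E h = harmonic E 1%g.
Proof.
move=> sE inv; have [mE _] := sE.
apply/eqP; rewrite -subr_eq0 -normr_le0; apply/ler_addgt0Pr => e e0.
have [n [e' e'e]] := inv e e0.
move=> /(_ (harmonic E) (fun x => harmonic_le1 x mE)).
have -> : iter n (walk_op nu) (harmonic E) = harmonic E.
  by elim: n => [//|n IH]; rewrite iterS IH walk_op_harmonic.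
by rewrite add0r => /le_trans; apply; exact: ltW.
Qed.

Lemma shift_invariant_almost_fixed (N : set G) : is_normal_subgroup N ->
  (forall h, N h -> forall e : R, 0 < e ->
     exists n, exists2 e', e' < e & almost_invariant nu h n e') ->
  forall E h, N h -> shift_invariant E ->
  eta (E `+` (@translate G h @^-1` E)) = 0%E.
Proof.
move=> [_ normN] inv E h Nh sE; have [mE _] := sE.
have shE := shift_invariant_translate h sE; have [mhE _] := shE.
have hEE : harmonic E = harmonic (@translate G h @^-1` E).
  apply/funext => g; rewrite harmonic_translate.
  (* Normality turns left translation by [h] into right translation by [h ^ g], to which the
     previous lemma applies for the translated event. *)
  have -> : (h * g = g * h ^ g)%g by exact: conjgC.
  rewrite -harmonic_translate (@harmonic_almost_invariant (@translate G g @^-1` E))//.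
  - by rewrite harmonic_translate mulg1.
  - exact: shift_invariant_translate.
  - by move=> e e0; apply: inv => //; exact: normN.
have dE := harmonic_determines sE shE hEE.
(* Here [E] and its translate are compared on the complement of the translate. *)
have DE : eta (E `\` (@translate G h @^-1` E)) = 0%E.
  by rewrite setDE setIC (dE _ (measurableC mhE)) setICl measure0.
have ED : eta ((@translate G h @^-1` E) `\` E) = 0%E.
  by rewrite setDE setIC -(dE _ (measurableC mE)) setICl measure0.
apply: null_set_setU => //; exact: measurableD.
Qed.

End walk_distribution.

(** * The action on the boundary *)

(** Preimages of a countable base. One implication suffices, as some basic open set contains [f x]
    but not [f y]. *)
Lemma standard_borel_separating (R : realType) d (B : measurableType d) :
  standard_borel R B -> exists A : nat -> set B,
    (forall n, measurable (A n)) /\ forall x y, (forall n, A n x -> A n y) -> x = y.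
Proof.
move=> [X [f [hX [U0 cU [oU bU]] bijf mB]]].
have /countable_injP[e einj] := cU.
pose U n := xget set0 [set V | U0 V /\ e V = n].
have oUn n : open (U n).
  by rewrite /U; case: xgetP => [V _ [/oU]|_]//; exact: open0.
have Ue V : U0 V -> U (e V) = V.
  move=> UV; rewrite /U; case: xgetP => [W _ [UW eWV]|/(_ V)/=]; last by tauto.
  by apply: einj; rewrite ?inE.
exists (fun n => f @^-1` U n); split=> [n|x y Uxy].
  by rewrite mB; exists (U n) => //; exact: sub_sigma_algebra.
apply: (bij_inj bijf); apply/eqP; apply: contrapT => /negP fxy.
move: hX; rewrite open_hausdorff => /(_ _ _ fxy)[[P Q] /= [/set_mem Px /set_mem Qy] [oP oQ PQ]].
have [V [UV Vx] VP] := bU (f x) P (open_nbhs_nbhs (conj oP Px)).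
have := Uxy (e V); rewrite /= Ue// => /(_ Vx)/VP Py.
by have : (P `&` Q) (f y) by []; rewrite (eqP PQ).
Qed.

Section boundary_action.
Context (R : realType) (G : groupType) (countableG : countable [set: G]).
Context (N : set G) (normalN : is_normal_subgroup N).
Context (nu : probability (discr G) R).
Hypothesis charged : forall g : G, (0 < nu [set (g : discr G)])%E.
Hypothesis inv : forall h, N h -> forall e : R, 0 < e ->
  exists n, exists2 e', e' < e & almost_invariant nu h n e'.

Lemma charged_nondegenerate : nondegenerate_measure nu.
Proof.
apply/seteqP; split => // g _; apply: sub_gen_smallest; exact: charged.
Qed.

(** It is enough that each set of a countable separating family is fixed by [act g] up to a null
    set. *)
Lemma almost_invariant_acts_trivially : acts_trivially_on_boundary N nu.
Proof.
move=> eta walk d B mu bnd act [sB mbnd law binv _] [mact equiv] g Ng.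
have mpre A : measurable A -> measurable (bnd @^-1` A).
  by move=> mA; rewrite -[X in measurable X]setTI; exact: mbnd.
have mact' A : measurable A -> measurable (act g @^-1` A).
  by move=> mA; rewrite -[X in measurable X]setTI; exact: mact.
have mY d' (T : measurableType d') (C D : set T) :
    measurable C -> measurable D -> measurable (C `+` D).
  by move=> mC mD; apply: measurableU; exact: measurableD.
have fixA A : measurable A -> mu.-negligible (A `+` act g @^-1` A).
  move=> mA; have mAact := mY _ _ _ _ mA (mact' _ mA).
  apply/negligibleP => //; transitivity (eta (bnd @^-1` (A `+` act g @^-1` A))).
    exact: law.
  apply/negligibleP; first exact: mpre.
  have [E sE AE] := binv A mA; have [mE _] := sE.
  have mAE := mY _ _ _ _ (mpre _ mA) mE.
  have n1 : eta.-negligible ((bnd @^-1` A) `+` E) by exact/negligibleP.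
  have n2 : eta.-negligible (E `+` @translate G g @^-1` E).
    apply/negligibleP; first by apply: mY => //; exact: measurable_translate_preimage.
    exact: (shift_invariant_almost_fixed countableG walk normalN inv).
  have n3 : eta.-negligible (@translate G g @^-1` ((bnd @^-1` A) `+` E)).
    apply/negligibleP; first exact: measurable_translate_preimage.
    exact: (translate_null countableG walk charged).
  have n4 := equiv g.
  apply: negligibleS (negligibleU (negligibleU n1 n2) (negligibleU n3 n4)) => w /=.
  rewrite /setY /= => AactA.
  apply: contrapT; move: AactA; rewrite /setD /=.
  have [<-|] := pselect (bnd (translate g w) = act g (bnd w)); last by tauto.
  by case: (pselect (A (bnd w))); case: (pselect (A (bnd (translate g w))));
    case: (pselect (E w)); case: (pselect (E (translate g w))); tauto.
have [A [mA sepA]] := standard_borel_separating sB.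
apply: negligibleS (negligible_bigcup (fun n => fixA (A n) (mA n))) => b /= actb.
apply: contrapT => nb; apply: actb; apply: sepA => n Aactb.
by apply: contrapT => nAb; apply: nb; exists n => //; right.
Qed.

End boundary_action.

(** * Intersection of the countably many generic conditions *)

Theorem corollary1 (R : realType) (G : groupType) (countableG : countable [set: G])
    (N : set G) (radN : is_amenable_radical R N) :
  residual [set nu : probability (discr G) R |
    nondegenerate_measure nu /\ acts_trivially_on_boundary N nu].
Proof.
have [normN amenN _] := radN.
have [c [d cK]] := countable_enum countableG.
pose U (i : nat) : set (probability (discr G) R) :=
  [set nu | (0 < nu [set (d i : discr G)])%E].
pose V (i j : nat) : set (probability (discr G) R) := [set nu | N (d i) ->
  exists n, exists2 e', e' < j.+1%:R^-1 & almost_invariant nu (d i) n e'].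
pose W n := if unpickle n is Some (i, j) then U i `&` V i j else setT.
exists (\bigcap_n W n).
  exists W => // n; rewrite /W; case: unpickle => [[i j]|]; last first.
    by split; [exact: openT|move=> O O0 _; rewrite setIT].
  have oU : open (U i) by exact: open_charged.
  have dU : dense (U i) by exact: dense_charged.
  have [Ni|Ni] := pselect (N (d i)); last first.
    have -> : V i j = setT by apply/seteqP; split => // nu _ /Ni.
    by rewrite setIT.
  pose V' : set (probability (discr G) R) := [set nu |
    exists n, exists2 e', e' < j.+1%:R^-1 & almost_invariant nu (d i) n e'].
  have -> : V i j = V' by apply/seteqP; split => [nu /(_ Ni)//|nu Vnu _].
  have oV : open V' by exact: open_almost_invariant.
  have dV : dense V' by apply: (dense_almost_invariant countableG normN amenN Ni).
  split; first exact: openI.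
  move=> O O0 oO; rewrite setIA; apply: dV; last exact: openI.
  exact: dU.
move=> nu Wnu.
have UV g j : (0 < nu [set (g : discr G)])%E /\ (N g ->
    exists n, exists2 e', e' < j.+1%:R^-1 & almost_invariant nu g n e').
  by have := Wnu (pickle (c g, j)) I; rewrite /W pickleK /U /V /= cK.
have charged g : (0 < nu [set (g : discr G)])%E by have [] := UV g 0%N.
split; first exact: charged_nondegenerate.
apply: almost_invariant_acts_trivially => // h Nh e e0.
pose j := Num.truncn e^-1.
have [_ /(_ Nh)[n [e' e'j inv]]] := UV h j.
exists n, e' => //; apply: (lt_trans e'j).
by rewrite invf_plt ?posrE// truncnS_gt.
Qed.
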